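(* Let $\Omega$ be a nonempty set, $\mathcal{A}$ a quasi-semi-ring of subsets of $\Omega$, and $\mu:\mathcal{A}\to[0,\infty]$ a countably additive premeasure on $\mathcal{A}$ that is sigma-finite, i.e., there exists $\{A_i\}_{i \geq 1}\subset \mathcal{A}$ such that $\Omega = \bigcup_{i \geq 1} A_i$ and $\mu(A_i)<\infty$ for all $i \geq 1$. Let $\mu^*$ be the outer measure induced by $\mu$ and let $r(\mathcal{A})$ be the smallest ring of subsets of $\Omega$ containing $\mathcal{A}$. Then (the restriction of) $\mu^*$ is the unique measure on $r(\mathcal{A})$ that agrees with $\mu$ on $\mathcal{A}$.
   Context: A class $\mathcal{A}$ of subsets of a nonempty set $\Omega$ is a quasi-semi-ring if (1) $\varnothing \in \mathcal{A}$, and (2) for all $A, B \in \mathcal{A}$ there exist finitely many pairwise disjoint sets $B_1, \ldots, B_n, C_1, \ldots, C_k \in \mathcal{A}$ (with $n,k<\infty$) such that $A \cap B = \bigcup_{i=1}^n B_i$ and $A \cap B^c = \bigcup_{i=1}^k C_i$. (Closure under intersections is not required.) A (countably additive) premeasure on $\mathcal{A}$ is a function $\mu:\mathcal{A}\to[0,\infty]$ with $\mu(\varnothing)=0$ that is countably additive: whenever $\{A_j\}_{j\ge1}\subset\mathcal{A}$ are pairwise disjoint and $\bigcup_{j\ge1}A_j\in\mathcal{A}$, then $\mu(\bigcup_{j\ge1}A_j)=\sum_{j\ge1}\mu(A_j)$. The outer measure induced by $\mu$ is the function $\mu^*$ from the power set of $\Omega$ to $[0,\infty]$ given by $\mu^*(A)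 = \inf\{ \sum_{j\geq 1} \mu(A_j) : A \subset \bigcup_{j\geq 1} A_j,\ \{A_j\}_{j\geq 1} \subset \mathcal{A}\}$, where the covers are countable and $\inf\varnothing=\infty$. A ring of sets is a nonempty class of subsets of $\Omega$ closed under finite unions and set differences. For a quasi-semi-ring, $r(\mathcal{A})$ consists exactly of the finite unions of pairwise disjoint sets from $\mathcal{A}$. A measure on the ring $r(\mathcal{A})$ is a function $\nu:r(\mathcal{A})\to[0,\infty]$ with $\nu(\varnothing)=0$ that is countably additive on pairwise disjoint sequences in $r(\mathcal{A})$ whose union lies in $r(\mathcal{A})$. *)

(* Defs.v *)
From mathcomp Require Import all_boot all_order all_algebra.
From mathcomp Require Import all_classical all_reals all_analysis.

Set Implicit Arguments.
Unset Strict Implicit.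
Unset Printing Implicit Defensive.

Import Order.TTheory GRing.Theory Num.Theory.
Local Open Scope classical_set_scope.
Local Open Scope ring_scope.
Local Open Scope ereal_scope.

(* The intersection counterpart of the library's [semi_setD_closed]. As there, a
   finite list of pairwise disjoint sets is encoded as a finite set of sets;
   repeating the empty set in a list is the only thing this forgets. *)
Definition semi_setI_closed (T : Type) (A : set (set T)) :=
  forall X Y, A X -> A Y -> exists D : set (set T),
    [/\ finite_set D, D `<=` A, X `&` Y = \bigcup_(Z in D) Z & trivIset D id].

(* The sets making up [X `&` Y] are automatically disjoint from those making up
   [X `\` Y], so disjointness is only required within each family. *)
Definition quasi_semi_ring (T : Type) (A : set (set T)) :=
  [/\ A set0, semi_setI_closed A & semi_setD_closed A].

(* A set function on a class [A] is given by a total function of which only the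
   values on [A] matter. When [A] is a quasi-semi-ring this is a premeasure, and
   when [A] is a ring it is a measure on that ring. The library's [measure] is
   not usable here, as it needs the domain to be at least a semiring of sets. *)
Definition measure_on (R : realType) (T : Type) (A : set (set T))
    (mu : set T -> \bar R) :=
  [/\ mu set0 = 0,
      forall X, A X -> 0 <= mu X &
      forall F : (set T)^nat, (forall j, A (F j)) -> trivIset setT F ->
        A (\bigcup_j F j) ->
        mu (\bigcup_j F j) = \sum_(0 <= j <oo) mu (F j)].

Definition sigma_finite_on (R : realType) (T : Type) (A : set (set T))
    (mu : set T -> \bar R) :=
  exists F : (set T)^nat,
    [/\ forall i, A (F i), [set: T] = \bigcup_i F i &
        forall i, mu (F i) < +oo].

(* The library's [mu_ext], for an arbitrary class of covering sets. *)
Definition outer_ext (R : realType) (T : Type) (A : set (set T))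
    (mu : set T -> \bar R) (X : set T) : \bar R :=
  ereal_inf [set \sum_(0 <= j <oo) mu (F j) | F in
    [set F : (set T)^nat | (forall j, A (F j)) /\ X `<=` \bigcup_j F j]].

(* Main.v *)
(* Two facts reduce everything to Caratheodory's theorem. First, finite disjoint
   unions of sets of A form a ring, so a cover of X in A by sets of A can be made
   disjoint and cut into countably many pairwise disjoint sets of A partitioning
   X; hence mu X is at most the mass of the cover, and mu^* = mu on A. Second,
   each set of A is Caratheodory measurable for mu^*. The Caratheodory measurable
   sets form a ring on which mu^* is countably additive, so mu^* is a measure on
   r(A). Two measures on r(A) agreeing on A agree on finite disjoint unions of
   sets of A, that is, on r(A). *)
From HB Require Import structures.
Require Import Defs.
From mathcomp Require Import all_boot all_order all_algebra.
From mathcomp Require Import all_classical all_reals all_analysis.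
Set Implicit Arguments.
Unset Strict Implicit.
Unset Printing Implicit Defensive.

Import Order.TTheory GRing.Theory Num.Theory.
Local Open Scope classical_set_scope.
Local Open Scope ring_scope.
Local Open Scope ereal_scope.

(** * Sums over countable families of sets *)

(** Covers and additivity are defined with sequences, whereas pieces come indexed by sets or pairs.
    An injective code [f] into the naturals translates one into the other; gaps are filled by the
    empty set, whose mass is 0. *)
Lemma countable_family_nat (T : Type) (A : set (set T)) (I : choiceType)
    (K : set I) (F : I -> set T) :
  A set0 -> countable K -> (forall i, K i -> A (F i)) ->
  exists G : (set T)^nat, [/\ forall n, A (G n),
    \bigcup_n G n = \bigcup_(i in K) F i,
    trivIset K F -> trivIset setT G &
    forall (R : realType) (mu : set T -> \bar R), mu set0 = 0 ->
      (forall X, A X -> 0 <= mu X) ->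
      \sum_(0 <= n <oo) mu (G n) = \esum_(i in K) mu (F i)].
Proof.
move=> A0 /countable_injP[f finj] AF.
(* As [f] is injective on [K], this union has at most one member. *)
pose G n := \bigcup_(i in K `&` [set i | f i = n]) F i.
have GE i : K i -> G (f i) = F i.
  move=> Ki; apply/seteqP; split => [x [j [Kj /= fji] Fjx]|x Fix]; last first.
    by exists i.
  by rewrite -(finj _ _ _ _ fji) ?inE.
have G0 n : ~ (f @` K) n -> G n = set0.
  by move=> nfK; rewrite -subset0 => x [i [Ki fin] _]; case: nfK; exists i.
have GA n : A (G n).
  have [[i Ki <-]|/G0 ->//] := pselect ((f @` K) n).
  by rewrite GE//; exact: AF.
exists G; split => //.
- apply/seteqP; split => [x [n _ [i [Ki _] Fix]]|x [i Ki Fix]].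
    by exists i.
  by exists (f i) => //; rewrite GE.
- move=> tF m n _ _ [x [[i [Ki /= <-] Fix] [j [Kj /= <-] Fjx]]].
  by rewrite (tF i j) //; exists x.
- move=> R mu mu0 mu_ge0; rewrite nneseries_esumT; last by move=> n; exact: mu_ge0.
  rewrite (_ : \esum_(n in setT) _ = \esum_(n in f @` K) mu (G n)); last first.
    rewrite [RHS]esum_mkcond; apply: eq_esum => n _.
    case: ifPn => //; rewrite notin_setE => /G0 ->; exact: mu0.
  rewrite esum_image//; first by apply: eq_esum => i Ki; rewrite GE.
Qed.

Lemma measure_on_esum (R : realType) (T : Type) (A : set (set T))
    (mu : set T -> \bar R) (I : choiceType) (K : set I) (F : I -> set T) :
  A set0 -> measure_on A mu -> countable K -> trivIset K F ->
  (forall i, K i -> A (F i)) -> A (\bigcup_(i in K) F i) ->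
  mu (\bigcup_(i in K) F i) = \esum_(i in K) mu (F i).
Proof.
move=> A0 [mu0 mu_ge0 muU] cK tF AF AUF.
have [G [AG GF tG sumG]] := countable_family_nat A0 cK AF.
by rewrite -GF muU ?sumG ?GF//; exact: tG.
Qed.

(** The disjoint sum of the index sets makes one family of the two, and keeps apart an empty set
    that occurs in both. *)
Lemma measure_on_esumU (R : realType) (T : Type) (A : set (set T))
    (mu : set T -> \bar R) (I J : choiceType) (K : set I) (L : set J)
    (F : I -> set T) (G : J -> set T) X :
  A set0 -> measure_on A mu -> A X -> countable K -> countable L ->
  trivIset K F -> trivIset L G ->
  (forall i, K i -> A (F i)) -> (forall j, L j -> A (G j)) ->
  X = \bigcup_(i in K) F i `|` \bigcup_(j in L) G j ->
  \bigcup_(i in K) F i `&` \bigcup_(j in L) G j = set0 ->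
  mu X = \esum_(i in K) mu (F i) + \esum_(j in L) mu (G j).
Proof.
move=> A0 muA AX cK cL tF tG AF AG XE FG0.
pose S : set (I + J) := inl @` K `|` inr @` L.
pose H (k : I + J) := match k with inl i => F i | inr j => G j end.
have SX : \bigcup_(k in S) H k = X by rewrite bigcup_setU !bigcup_image.
have AH k : S k -> A (H k) by move=> [[i Ki <-]|[j Lj <-]]; [exact: AF|exact: AG].
have FG i j x : K i -> L j -> F i x -> G j x -> False.
  by move=> Ki Lj Fx Gx; rewrite -[False]/(set0 x) -FG0; split; [exists i|exists j].
have cS : countable S.
  rewrite /S -bigcup2E; apply: bigcup_countable => // -[|[|n]] _ /=.
  - exact: sub_countable (card_image_le _ _) cK.
  - exact: sub_countable (card_image_le _ _) cL.
  - exact: countable0.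
have tH : trivIset S H.
  move=> _ _ [[i Li <-]|[Z DZ <-]] [[j Lj <-]|[W DW <-]] [x [/= Hx Hx']].
  - by rewrite (tF i j)//; exists x.
  - by have := FG _ _ _ Li DW Hx Hx'.
  - by have := FG _ _ _ Lj DZ Hx' Hx.
  - by rewrite (tG Z W)//; exists x.
rewrite -SX (measure_on_esum A0 muA)// ?SX//.
have H_ge0 k : S k -> 0 <= mu (H k) by case: muA => _ mu_ge0 _ /AH /mu_ge0.
rewrite (esumID (inl @` K))//; congr (_ + _).
  rewrite (_ : S `&` _ = inl @` K); last by apply/setIidPr; left.
  by rewrite esum_image// => i j _ _ [].
rewrite (_ : S `&` _ = inr @` L); last first.
  apply/seteqP; split => [k [[//|[j Lj <-] _]]|_ [j Lj <-]]; first by exists j.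
  by split => [|[]//]; right; exists j.
by rewrite esum_image// => i j _ _ [].
Qed.

Lemma outer_ext_le_esum (R : realType) (T : Type) (A : set (set T))
    (mu : set T -> \bar R) (I : choiceType) (K : set I) (F : I -> set T) X :
  A set0 -> mu set0 = 0 -> (forall Y, A Y -> 0 <= mu Y) -> countable K ->
  (forall i, K i -> A (F i)) -> X `<=` \bigcup_(i in K) F i ->
  outer_ext A mu X <= \esum_(i in K) mu (F i).
Proof.
move=> A0 mu0 mu_ge0 cK AF XF.
have [G [AG GF _ sumG]] := countable_family_nat A0 cK AF.
by apply: ereal_inf_lbound; exists G; rewrite ?sumG//= GF.
Qed.

(** * The outer measure induced by a set function *)

Section outer_ext_outer_measure.
Variables (R : realType) (T : Type) (A : set (set T)) (mu : set T -> \bar R).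
Hypotheses (A0 : A set0) (mu0 : mu set0 = 0).
Hypothesis mu_ge0 : forall X, A X -> 0 <= mu X.

Lemma outer_ext_ge0 X : 0 <= outer_ext A mu X.
Proof.
apply: le_ereal_inf_tmp => _ [F [AF _] <-].
by apply: nneseries_ge0 => n _ _; exact: mu_ge0.
Qed.

Lemma le_outer_ext : {homo outer_ext A mu : X Y / X `<=` Y >-> X <= Y}.
Proof.
move=> X Y XY; apply: ereal_inf_le_tmp => _ [F [AF YF] <-].
by exists F => //; split => //; exact: subset_trans YF.
Qed.

Lemma outer_ext_le X : A X -> outer_ext A mu X <= mu X.
Proof.
move=> AX; rewrite -(@esum_set1 R _ X (fun X => mu X))//; last exact: mu_ge0.
by apply: outer_ext_le_esum => // [_ ->//|]; rewrite bigcup_set1.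
Qed.

Lemma outer_ext0 : outer_ext A mu set0 = 0.
Proof. by apply/eqP; rewrite eq_le outer_ext_ge0 -mu0 outer_ext_le. Qed.

Lemma outer_ext_sigma_subadditive : sigma_subadditive (outer_ext A mu).
Proof.
(* An infinite term makes the right side infinite. Otherwise each infimum is finite, so it can be
   approached within any positive error. *)
move=> X; have [[n Xn]|noo] := pselect (exists n, outer_ext A mu (X n) = +oo).
  rewrite (eseries_pinfty _ _ Xn) ?leey// => k _.
  by rewrite gt_eqF// (lt_le_trans _ (outer_ext_ge0 _)).
apply/lee_addgt0Pr => e e0.
rewrite (le_trans _ (epsilon_trick _ _ (ltW e0)))//; last first.
  by move=> n; exact: outer_ext_ge0.
have /choice[F FP] n : exists F : (set T)^nat,
    [/\ forall j, A (F j), X n `<=` \bigcup_j F j &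
      \sum_(0 <= j <oo) mu (F j) <= outer_ext A mu (X n) +
                                    (e / (2 ^ n.+1)%:R)%:E].
  have e'0 : (0 < e / (2 ^ n.+1)%:R)%R.
    by rewrite divr_gt0// ltr0n expn_gt0.
  have fX : outer_ext A mu (X n) \is a fin_num.
    by rewrite ge0_fin_numE ?outer_ext_ge0// ltey; apply/eqP => Xoo; apply: noo; exists n.
  have [_ [F [AF XF] <-] lt] := lb_ereal_inf_adherent e'0 fX.
  by exists F; split => //; exact: ltW.
have AF n j : A (F n j) by case: (FP n).
(* The chosen covers together form one countable cover, indexed by pairs. *)
apply: (@le_trans _ _ (\esum_(k in [set: nat] `*`` fun=> [set: nat])
    mu (F k.1 k.2))).
  apply: outer_ext_le_esum => // [|x [n _ Xnx]]; first exact: countableP.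
  by have [_ /(_ _ Xnx)[j _ Fx] _] := FP n; exists (n, j).
rewrite -(@esum_esum _ _ _ _ _ (fun n j => mu (F n j))); last first.
  by move=> *; exact: mu_ge0.
rewrite [leRHS]nneseries_esumT; last first.
  move=> n; rewrite adde_ge0 ?outer_ext_ge0// lee_fin divr_ge0//.
  by rewrite ltW.
apply: le_esum => n _; rewrite -nneseries_esumT; last by move=> j; exact: mu_ge0.
by case: (FP n).
Qed.

(** Gives access to the Caratheodory theory of [outer_measure]; an existence statement, since the
    structure depends on the hypotheses on [A] and [mu]. *)
Lemma outer_ext_outer_measure :
  exists m : {outer_measure set T -> \bar R}, m = outer_ext A mu :> (_ -> _).
Proof.
pose M := isOuterMeasure.Build R T (outer_ext A mu) outer_ext0 outer_ext_ge0
  le_outer_ext outer_ext_sigma_subadditive.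
by exists (HB.pack_for {outer_measure set T -> \bar R} (outer_ext A mu) M).
Qed.

End outer_ext_outer_measure.

(** * The ring of finite disjoint unions *)

Definition disjoint_unions (T : Type) (A : set (set T)) : set (set T) :=
  [set X | exists D : set (set T),
    [/\ finite_set D, D `<=` A, X = \bigcup_(Z in D) Z & trivIset D id]].

Lemma disjoint_unions_sub (T : Type) (A : set (set T)) :
  A `<=` disjoint_unions A.
Proof.
move=> X AX; exists [set X]; split => [//|_ -> //||_ _ -> -> //].
by rewrite bigcup_set1.
Qed.

Lemma disjoint_unions_bigcup (T : Type) (A : set (set T)) (I : Type)
    (K : set I) (F : I -> set T) :
  finite_set K -> trivIset K F -> (forall i, K i -> disjoint_unions A (F i)) ->
  disjoint_unions A (\bigcup_(i in K) F i).
Proof.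
move=> finK tF AF.
(* For [i] outside [K] the empty family serves as a default. *)
have /choice[D DP] i : exists D : set (set T), K i ->
    [/\ finite_set D, D `<=` A, F i = \bigcup_(Z in D) Z & trivIset D id].
  have [/AF[D DP]|nKi] := pselect (K i); [by exists D|by exists set0].
exists (\bigcup_(i in K) D i); split.
- by apply: bigcup_finite => // i /DP[].
- by move=> Z [i /DP[_ + _ _]]; exact.
- rewrite bigcup_bigcup; apply: eq_bigcupr => i Ki.
  by have [_ _ -> _] := DP _ Ki.
- move=> Y Z [i Ki DiY] [j Kj DjZ] [x [/= Yx Zx]].
  have [_ _ FiE tD] := DP _ Ki; have [_ _ FjE _] := DP _ Kj.
  (* Pieces that meet force [F i] and [F j] to meet. *)
  have ij : i = j.
    apply: tF => //; exists x; rewrite FiE FjE.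
    by split; [exists Y|exists Z].
  by apply: tD => //; [rewrite ij|exists x].
Qed.

Section disjoint_unions_setring.
Variables (T : Type) (A : set (set T)).
Hypotheses (A0 : A set0) (AD : semi_setD_closed A).

Lemma disjoint_unions_setD1 X Y :
  disjoint_unions A X -> A Y -> disjoint_unions A (X `\` Y).
Proof.
move=> [D [finD DA -> tD]] AY; rewrite setDE setI_bigcupl.
apply: disjoint_unions_bigcup => // [|Z DZ].
  exact: trivIset_setIr.
by rewrite -setDE; apply: AD => //; exact: DA.
Qed.

(** The finitely many pieces of the second set are removed one at a time, so the first set must stay
    general in the induction. *)
Lemma disjoint_unions_setD : setD_closed (disjoint_unions A).
Proof.
move=> X Y AX [_ [/finite_seqP[s ->] + -> _]].
elim: s X AX => [|Z s ih] X AX sA; first by rewrite set_nil bigcup_set0 setD0.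
have -> : [set` Z :: s] = Z |` [set` s].
  by apply/seteqP; split => W /=; rewrite in_cons;
    [move=> /orP[/eqP|]; [left|right]|move=> [->|->]; rewrite ?eqxx ?orbT].
rewrite bigcup_setU1 -setDDl; apply: ih => [|W sW].
  by apply: disjoint_unions_setD1 => //; apply: sA; rewrite /= mem_head.
by apply: sA; rewrite /= inE; apply/orP; right.
Qed.

Lemma setring_disjoint_unions : setring (disjoint_unions A).
Proof.
split; [exact: disjoint_unions_sub| |exact: disjoint_unions_setD].
move=> X Y AX AY.
(* The union is made disjoint by replacing [Y] with its part outside [X]. *)
rewrite (_ : X `|` Y = \bigcup_(b in [set: bool]) if b then X else Y `\` X).
  apply: disjoint_unions_bigcup => // [|[] _//].
    by move=> [] [] _ _ // [x []] => [Xx []|[]].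
  exact: disjoint_unions_setD.
apply/seteqP; split => [x [Xx|Yx]|x [[] _ //]]; first by exists true.
- by have [Xx|nXx] := pselect (X x); [exists true|exists false].
- by left.
- by move=> []; right.
Qed.

Lemma disjoint_unions_setI : setI_closed (disjoint_unions A).
Proof.
move=> X Y AX AY; rewrite -setDD.
by apply: disjoint_unions_setD => //; exact: disjoint_unions_setD.
Qed.

Lemma setring_gen_disjoint_unions : <<r A >> `<=` disjoint_unions A.
Proof.
apply: smallest_sub; [exact: setring_disjoint_unions|exact: disjoint_unions_sub].
Qed.

End disjoint_unions_setring.

(** * Agreement with the premeasure and Caratheodory measurability *)

Section premeasure_extension.
Variables (R : realType) (T : Type) (A : set (set T)) (mu : set T -> \bar R).
Hypotheses (A0 : A set0) (AD : semi_setD_closed A) (muA : measure_on A mu).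

Let mu0 : mu set0 = 0. Proof. by case: muA. Qed.
Let mu_ge0 X : A X -> 0 <= mu X. Proof. by case: muA => _ + _; exact. Qed.

(** What finitely many of the sets leave of [X] is again a finite disjoint union of sets of [A], so
    [mu X] is their mass plus a nonnegative remainder. Finite subfamilies suffice, [esum] being the
    supremum of their sums. *)
Lemma esum_trivIset_le (I : choiceType) (K : set I) (F : I -> set T) X :
  A X -> trivIset K F -> (forall i, K i -> A (F i)) ->
  (forall i, K i -> F i `<=` X) -> \esum_(i in K) mu (F i) <= mu X.
Proof.
move=> AX tF AF FX; apply: ge_ereal_sup => _ [L [finL LK] <-].
have tL : trivIset L F by exact: sub_trivIset tF.
have : disjoint_unions A (X `\` \bigcup_(i in L) F i).
  apply: disjoint_unions_setD => //; first exact: disjoint_unions_sub.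
  apply: disjoint_unions_bigcup => //.
  by move=> i /LK /AF; exact: disjoint_unions_sub.
move=> [D [finD DA XLD tD]].
have cL : countable L by exact: finite_set_countable.
have cD : countable D by exact: finite_set_countable.
have AL i : L i -> A (F i) by move=> /LK /AF.
have LX : \bigcup_(i in L) F i `<=` X by move=> x [i Li]; exact: FX (LK _ Li) _.
rewrite (measure_on_esumU A0 muA AX cL cD tL tD AL DA)//=; last 2 first.
- by rewrite -XLD setDUK.
- by rewrite -XLD setDIK.
rewrite esum_fset//; last by move=> i; rewrite inE => /LK /AF /mu_ge0.
by rewrite leeDl// esum_ge0// => Z /DA /mu_ge0.
Qed.

(** With [H n] the part of [X] first covered by [F n], the pieces of all the [H n] partition [X].
    Those of a single [H n] lie in [F n], so their total mass is at most [mu (F n)]. *)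
Lemma measure_on_sigma_subadditive X (F : (set T)^nat) :
  A X -> (forall n, A (F n)) -> X `<=` \bigcup_n F n ->
  mu X <= \sum_(0 <= n <oo) mu (F n).
Proof.
move=> AX AF XF; pose H := seqDU (fun n => X `&` F n).
have HX : \bigcup_n H n = X.
  by rewrite -seqDU_bigcup_eq -setI_bigcupr; apply/setIidPl.
have AU Y : A Y -> disjoint_unions A Y by exact: disjoint_unions_sub.
have HU n : disjoint_unions A (H n).
  rewrite /H seqDUIE; apply: disjoint_unions_setD => //.
    by apply: disjoint_unions_setI => //; exact: AU.
  have [U0 UU _] := setring_disjoint_unions A0 AD.
  have /fin_bigcup_closedP UB := conj U0 UU.
  by apply: UB => [|i _]; [exact: finite_II|exact: AU].
have /choice[D DP] := HU.
have DA n Z : D n Z -> A Z by case: (DP n) => _ + _ _; exact.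
have DH n Z : D n Z -> Z `<=` H n.
  by move=> DZ; have [_ _ -> _] := DP n; exact: bigcup_sup.
(* Pairs are used as indices because the empty set may be a piece of several [H n]. *)
pose K := [set: nat] `*`` D.
have KX : \bigcup_(k in K) k.2 = X.
  rewrite -HX; apply/seteqP; split => [x [[n Z] [_ DZ] Zx]|x [n _]].
    by exists n => //; exact: DH DZ _ Zx.
  by have [_ _ -> _] := DP n => -[Z DZ Zx]; exists (n, Z).
rewrite -KX (measure_on_esum A0 muA); last first.
- by rewrite KX.
- by move=> [n Z] [_ /DA].
- move=> [n Z] [m W] [/= _ DZ] [/= _ DW] [x [/= Zx Wx]].
  have nm : n = m.
    apply: (trivIset_seqDU (fun n => X `&` F n)) => //.
    by exists x; split; [exact: DH DZ _ Zx|exact: DH DW _ Wx].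
  by subst m; have [_ _ _ tD] := DP n; rewrite (tD Z W)//; exists x.
- apply: countableXR => [|n _]; first exact: countableP.
  by apply: finite_set_countable; case: (DP n).
rewrite -(@esum_esum _ _ _ _ _ (fun _ Z => mu Z)); last first.
  by move=> n Z _ /DA /mu_ge0.
rewrite nneseries_esumT; last by move=> n; exact: mu_ge0.
apply: le_esum => n _; apply: esum_trivIset_le => // [|Z /DA//|Z DZ x Zx].
  by case: (DP n).
by have [] := DH _ _ DZ _ Zx => -[].
Qed.

Lemma outer_extE X : A X -> outer_ext A mu X = mu X.
Proof.
move=> AX; apply/eqP; rewrite eq_le outer_ext_le//=.
apply: le_ereal_inf_tmp => _ [F [AF XF] <-].
exact: measure_on_sigma_subadditive.
Qed.

(* Splitting each set [F n] of a cover along [X] costs nothing, since [mu (F n)]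
   is the sum of [mu] over the pieces of [F n `&` X] and of [F n `\` X]. *)
Lemma outer_ext_caratheodory X : A X -> caratheodory_measurable (outer_ext A mu) X.
Proof.
have [m mE] := outer_ext_outer_measure A0 mu0 mu_ge0; rewrite -mE.
move=> AX; apply: le_caratheodory_measurable => E; rewrite mE.
rewrite [leRHS]/outer_ext; apply: le_ereal_inf_tmp => _ [F [AF EF] <-].
have split_le Y : A Y ->
    outer_ext A mu (Y `&` X) + outer_ext A mu (Y `&` ~` X) <= mu Y.
  move=> AY; have AU Z : A Z -> disjoint_unions A Z.
    exact: disjoint_unions_sub.
  have [D [finD DA YXD tD]] : disjoint_unions A (Y `&` X).
    by apply: disjoint_unions_setI => //; exact: AU.
  have [D' [finD' D'A YX'D tD']] := AD AY AX.
  have cD : countable D by exact: finite_set_countable.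
  have cD' : countable D' by exact: finite_set_countable.
  rewrite (measure_on_esumU A0 muA AY cD cD' tD tD' DA D'A) /=.
  - by apply: leeD; apply: outer_ext_le_esum => //; rewrite -?YXD -?YX'D.
  - by rewrite -YXD -YX'D setUIDK.
  - by rewrite -YXD -YX'D setIACA setICr setI0.
(* The parts of the [F n] inside [X] cover that of [E], and likewise outside [X];
   sigma-subadditivity bounds both terms. *)
apply: (@le_trans _ _ (\sum_(0 <= n <oo) (m (F n `&` X) + m (F n `&` ~` X)))).
  rewrite nneseriesD; try by move=> *; exact: outer_measure_ge0.
  rewrite -mE; apply: leeD.
    apply: le_trans (outer_measure_sigma_subadditive m _).
    by rewrite -setI_bigcupl; apply: le_outer_measure; exact: setSI.
  apply: le_trans (outer_measure_sigma_subadditive m _).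
  by rewrite -setI_bigcupl; apply: le_outer_measure; exact: setSI.
apply: lee_nneseries => n _; first by rewrite adde_ge0// outer_measure_ge0.
by rewrite mE; exact: split_le.
Qed.

End premeasure_extension.

(** * Restriction to the generated ring, and uniqueness *)

Lemma sub_measure_on (R : realType) (T : Type) (A B : set (set T))
    (mu : set T -> \bar R) :
  B `<=` A -> measure_on A mu -> measure_on B mu.
Proof.
move=> BA [mu0 mu_ge0 muU]; split => // [X /BA|F BF tF /BA AF].
  exact: mu_ge0.
by apply: muU => // j; exact: BA.
Qed.

Lemma measure_on_caratheodory (R : realType) (T : Type)
    (m : {outer_measure set T -> \bar R}) :
  measure_on (caratheodory_measurable m) m.
Proof.
split => [|X _|F mF tF mUF]; [exact: outer_measure0|exact: outer_measure_ge0|].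
apply/eqP; rewrite eq_le outer_measure_sigma_subadditive/=.
(* With the union itself as test set, the term for its complement vanishes and each [F k] is met in
   full. *)
apply: le_trans (caratheodory_lime_le mF tF (\bigcup_k F k)).
rewrite setICr outer_measure0 adde0 le_eqVlt; apply/orP; left; apply/eqP.
by apply: eq_eseriesr => k _; congr (m _); apply/esym/setIidPr; exact: bigcup_sup.
Qed.

Lemma setring_caratheodory (R : realType) (T : Type)
    (m : {outer_measure set T -> \bar R}) :
  setring (caratheodory_measurable m).
Proof.
split; [exact: caratheodory_measurable_set0|
  exact: caratheodory_measurable_setU|exact: caratheodory_measurable_setD].
Qed.

Theorem theorem1p3 (R : realType) (Omega : Type) (A : set (set Omega))
    (mu : set Omega -> \bar R)
    (Omega_neq0 : [set: Omega] !=set0)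
    (qsrA : quasi_semi_ring A)
    (mu_premeasure : measure_on A mu)
    (mu_sigma_finite : sigma_finite_on A mu) :
  [/\ measure_on <<r A >> (outer_ext A mu),
      forall X, A X -> outer_ext A mu X = mu X &
      forall nu : set Omega -> \bar R,
        measure_on <<r A >> nu -> (forall X, A X -> nu X = mu X) ->
        forall X, <<r A >> X -> nu X = outer_ext A mu X].
Proof.
have [A0 _ AD] := qsrA; have [mu0 mu_ge0 _] := mu_premeasure.
have extE : forall X, A X -> outer_ext A mu X = mu X by exact: outer_extE.
have ext_measure : measure_on <<r A >> (outer_ext A mu).
  have Acara X : A X -> caratheodory_measurable (outer_ext A mu) X.
    exact: outer_ext_caratheodory.
  have [m mE] := outer_ext_outer_measure A0 mu0 mu_ge0.
  rewrite -mE in Acara *; apply: sub_measure_on (measure_on_caratheodory m).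
  (* By minimality, the generated ring lies in any ring containing [A]. *)
  by apply: smallest_sub => //; exact: setring_caratheodory.
split => // nu nu_measure nuE X AX.
have [D [finD DA XD tD]] := setring_gen_disjoint_unions A0 AD AX.
have cD : countable D by exact: finite_set_countable.
have DrA Z : D Z -> <<r A >> Z by move=> /DA; exact: sub_setring.
have r0 : <<r A >> set0 by exact: setring0.
rewrite XD in AX *.
(* Both measures are sums over the same pieces [D], and on each piece both equal [mu]. *)
rewrite (measure_on_esum r0 nu_measure)// (measure_on_esum r0 ext_measure)//.
by apply: eq_esum => Z /DA AZ; rewrite nuE// extE.
Qed.
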